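(* Let $J\colon\mathcal S_n\to\mathbb R$ be strictly isotone with extension $\bar J$, and let Assumption (A1) hold. Let the function $\boldsymbol\alpha'\colon\mathcal D_F\to[0,1]$ be such that $$\bar J\big((\boldsymbol\alpha'H_1^\top\hat P_1^{-1}H_1+(1-\boldsymbol\alpha')H_2^\top\hat P_2^{-1}H_2)^{-1}\big)\le\bar J(\hat{\boldsymbol P}^{\boldsymbol\alpha})$$ (at every point of $\mathcal D_F$) for some $\boldsymbol\alpha\in\mathcal K_H^{\boldsymbol\alpha}$. Then $\boldsymbol\alpha'\in\mathcal K_H^{\boldsymbol\alpha}$. In particular, if $\boldsymbol\alpha^\ast\colon\mathcal D_F\to[0,1]$ is a solution of problem (CI) then $\boldsymbol\alpha^\ast\in\mathcal K_H^{\boldsymbol\alpha}$.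
   Context: $n,p_1,p_2$ are positive integers, $p_1,p_2\le n$, $H_1\in\mathbb R^{p_1\times n}$, $H_2\in\mathbb R^{p_2\times n}$, $H=\begin{pmatrix}H_1\\H_2\end{pmatrix}$. Assumption (A1): $\mathrm{rk}(H_1)=p_1$, $\mathrm{rk}(H_2)=p_2$, $\mathrm{rk}(H)=n$ (and the two input estimators $\hat x_1,\hat x_2$ are unbiased estimators of $H_1x_{\rm true}$, $H_2x_{\rm true}$; in the deterministic maps below only their values enter). $\mathcal S_m,\mathcal P_m,\mathcal P_m^\succ$: real symmetric, positive semi-definite, positive definite $m\times m$ matrices; $\preceq,\prec$ refer to the Löwner order. $\mathcal D_F:=\mathbb R^{p_1}\times\mathbb R^{p_2}\times\mathcal P_{p_1}^\succ\times\mathcal P_{p_2}^\succ$, with points denoted $(\hat x_1,\hat x_2,\hat P_1,\hat P_2)$. Statements about maps on $\mathcal D_F$ are read pointwise. $J$ is strictly isotone if $A\preceq B$ implies $J(A)\le J(B)$ and ($A\preceq B$, $A\ne B$) implies $J(A)<J(B)$, for all $A,B\in\mathcal S_n$. $\mathcal K_H^{\boldsymbol\alpha}$ denotes the set of all functions $\boldsymbol\alpha\colon\mathcal D_F\to[0,1]$ such that, at each point of $\mathcal D_F$: $\boldsymbol\alpha=0$ if $H_2^\top\hat P_2^{-1}H_2\succ H_1^\top\hat P_1^{-1}H_1$; $\boldsymbol\alpha\in[0,1]$ is arbitrary if $H_2^\top\hat P_2^{-1}H_2=H_1^\top\hat P_1^{-1}H_1$; $\boldsymbol\alpha=1$ if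 $H_2^\top\hat P_2^{-1}H_2\prec H_1^\top\hat P_1^{-1}H_1$; and otherwise $\boldsymbol\alpha\in[0,1]$ is such that $\boldsymbol\alpha H_1^\top\hat P_1^{-1}H_1+(1-\boldsymbol\alpha)H_2^\top\hat P_2^{-1}H_2$ is non-singular. For $\boldsymbol\alpha\in\mathcal K_H^{\boldsymbol\alpha}$, $\hat{\boldsymbol P}^{\boldsymbol\alpha}:=(\boldsymbol\alpha H_1^\top\hat P_1^{-1}H_1+(1-\boldsymbol\alpha)H_2^\top\hat P_2^{-1}H_2)^{-1}$. The extension $\bar J\colon\mathcal S_n\cup\{+\infty\}\to\mathbb R\cup\{+\infty\}$ is given by $\bar J(+\infty)=+\infty$ and $\bar J=J$ on $\mathcal S_n$; for singular $P\in\mathcal P_n$ set $P^{-1}:=+\infty$. Problem (CI): a solution is a function $\boldsymbol\alpha^\ast\colon\mathcal D_F\to[0,1]$ such that at every point of $\mathcal D_F$ and for every function $\boldsymbol\alpha\colon\mathcal D_F\to[0,1]$, $\bar J((\boldsymbol\alpha^\ast H_1^\top\hat P_1^{-1}H_1+(1-\boldsymbol\alpha^\ast)H_2^\top\hat P_2^{-1}H_2)^{-1})\le\bar J((\boldsymbol\alpha H_1^\top\hat P_1^{-1}H_1+(1-\boldsymbol\alpha)H_2^\top\hat P_2^{-1}H_2)^{-1})$. *)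

(* Defs.v *)
From HB Require Import structures.
From mathcomp Require Import all_boot all_order all_algebra.
From mathcomp Require Import sesquilinear interval_inference.
From mathcomp Require Import reals constructive_ereal.

Set Implicit Arguments.
Unset Strict Implicit.
Unset Printing Implicit Defensive.

Import Order.TTheory GRing.Theory Num.Theory.
Local Open Scope ring_scope.

Definition psdmx (R : realType) (m : nat) (A : 'M[R]_m) : Prop :=
  A \is symmetricmx /\ forall x : 'cV[R]_m, 0 <= (x^T *m A *m x) 0 0.

Definition pdmx (R : realType) (m : nat) (A : 'M[R]_m) : Prop :=
  A \is symmetricmx /\
  forall x : 'cV[R]_m, x != 0 -> 0 < (x^T *m A *m x) 0 0.

Definition loewner_le (R : realType) (m : nat) (A B : 'M[R]_m) : Prop :=
  psdmx (B - A).

Definition loewner_lt (R : realType) (m : nat) (A B : 'M[R]_m) : Prop :=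
  pdmx (B - A).

(* A map on the symmetric matrices is represented by a function on all square
   matrices of which only the values at symmetric matrices are used. *)
Definition strictly_isotone (R : realType) (n : nat) (J : 'M[R]_n -> R) : Prop :=
  forall A B : 'M[R]_n, A \is symmetricmx -> B \is symmetricmx ->
    loewner_le A B -> J A <= J B /\ (A <> B -> J A < J B).

(* [None] stands for the element +oo adjoined to the symmetric matrices. *)
Definition einvmx (R : realType) (n : nat) (A : 'M[R]_n) : option 'M[R]_n :=
  if A \in unitmx then Some (invmx A) else None.

Definition Jbar (R : realType) (n : nat) (J : 'M[R]_n -> R)
    (P : option 'M[R]_n) : \bar R :=
  if P is Some A then (J A)%:E else +oo%E.

Record DF (R : realType) (p1 p2 : nat) := MkDF {
  xhat1 : 'cV[R]_p1;
  xhat2 : 'cV[R]_p2;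
  Phat1 : 'M[R]_p1;
  Phat2 : 'M[R]_p2;
  Phat1_pd : pdmx Phat1;
  Phat2_pd : pdmx Phat2 }.

Definition assumptionA1 (R : realType) (n p1 p2 : nat)
    (H1 : 'M[R]_(p1, n)) (H2 : 'M[R]_(p2, n)) : Prop :=
  [/\ \rank H1 = p1, \rank H2 = p2 & \rank (col_mx H1 H2) = n].

Definition info1 (R : realType) (n p1 p2 : nat) (H1 : 'M[R]_(p1, n))
    (d : DF R p1 p2) : 'M[R]_n :=
  H1^T *m invmx (Phat1 d) *m H1.

Definition info2 (R : realType) (n p1 p2 : nat) (H2 : 'M[R]_(p2, n))
    (d : DF R p1 p2) : 'M[R]_n :=
  H2^T *m invmx (Phat2 d) *m H2.

Definition ci_info (R : realType) (n p1 p2 : nat)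
    (H1 : 'M[R]_(p1, n)) (H2 : 'M[R]_(p2, n))
    (alpha : DF R p1 p2 -> {i01 R}) (d : DF R p1 p2) : 'M[R]_n :=
  (alpha d)%:num *: info1 H1 d + (1 - (alpha d)%:num) *: info2 H2 d.

(* Where the two information matrices coincide, alpha is unconstrained. *)
Definition KH (R : realType) (n p1 p2 : nat)
    (H1 : 'M[R]_(p1, n)) (H2 : 'M[R]_(p2, n))
    (alpha : DF R p1 p2 -> {i01 R}) : Prop :=
  forall d : DF R p1 p2,
    [/\ loewner_lt (info1 H1 d) (info2 H2 d) -> (alpha d)%:num = 0,
        loewner_lt (info2 H2 d) (info1 H1 d) -> (alpha d)%:num = 1 &
        ~ loewner_lt (info1 H1 d) (info2 H2 d) ->
        info2 H2 d <> info1 H1 d ->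
        ~ loewner_lt (info2 H2 d) (info1 H1 d) ->
        ci_info H1 H2 alpha d \in unitmx].

Definition Phat_alpha (R : realType) (n p1 p2 : nat)
    (H1 : 'M[R]_(p1, n)) (H2 : 'M[R]_(p2, n))
    (alpha : DF R p1 p2 -> {i01 R}) (d : DF R p1 p2) : 'M[R]_n :=
  invmx (ci_info H1 H2 alpha d).

Definition CI_solution (R : realType) (n p1 p2 : nat) (J : 'M[R]_n -> R)
    (H1 : 'M[R]_(p1, n)) (H2 : 'M[R]_(p2, n))
    (alphas : DF R p1 p2 -> {i01 R}) : Prop :=
  forall (d : DF R p1 p2) (alpha : DF R p1 p2 -> {i01 R}),
    (Jbar J (einvmx (ci_info H1 H2 alphas d)) <=
     Jbar J (einvmx (ci_info H1 H2 alpha d)))%E.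

(* Main.v *)
Require Import Defs.
From mathcomp Require Import all_boot all_order all_algebra.
From mathcomp Require Import sesquilinear interval_inference.
From mathcomp Require Import reals constructive_ereal.

(** Fix a point of the domain and write [A] and [B] for the two information
    matrices there, both positive semidefinite.  The covariance
    [(t A + (1 - t) B)^-1] depends on [t] in an order-reversing way: inversion
    reverses the Loewner order ([invmx_anti]), and is injective, so a strictly
    isotone cost strictly increases whenever the information strictly
    decreases.  If [A] is strictly below [B], then [t A + (1 - t) B] is below
    [B], and differs from it unless [t = 0]; hence a weight costing no more
    than the weight [0] is [0] ([isotone_weight_eq0]).  Exchanging [A] and [B]
    gives the weight [1] in the opposite case.  In the remaining case
    membership in [KH] asks only that the information matrix be invertible,
    which is what a finite cost means ([KH_of_cost_bounds]).

    A function in [KH] takes the values [0] and [1] in the two ordered cases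
    and always gives a finite cost, so it provides exactly these comparisons.
    A solution of the CI problem can be compared directly with the constant
    weights [0], [1] and [1/2]; the last has finite cost because, the stacked
    matrix having full column rank, a combination of [A] and [B] with positive
    weights is positive definite ([pdmx_fused]). *)

Set Implicit Arguments.
Unset Strict Implicit.
Unset Printing Implicit Defensive.

Import Order.TTheory GRing.Theory Num.Theory.
Local Open Scope ring_scope.

(** * Positive (semi)definite matrices *)

Lemma symmetricmxP (R : realType) (m : nat) (A : 'M[R]_m) :
  (A \is symmetricmx) <-> A^T = A.
Proof.
rewrite is_hermitianmxE /= expr0 scale1r.
have -> : map_mx idfun A^T = A^T by apply/matrixP=> i j; rewrite !mxE.
by rewrite eq_sym; split=> /eqP.
Qed.

Lemma quad_comb (R : realType) (m : nat) (s t : R) (A B : 'M[R]_m)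
    (x : 'cV[R]_m) :
  (x^T *m (s *: A + t *: B) *m x) 0 0 =
  s * (x^T *m A *m x) 0 0 + t * (x^T *m B *m x) 0 0.
Proof. by rewrite mulmxDr mulmxDl -!scalemxAr -!scalemxAl mxE !mxE. Qed.

Lemma quad_congr (R : realType) (m k : nat) (A : 'M[R]_m) (C : 'M[R]_(m, k))
    (x : 'cV[R]_k) :
  x^T *m (C^T *m A *m C) *m x = (C *m x)^T *m A *m (C *m x).
Proof. by rewrite trmx_mul !mulmxA. Qed.

Lemma symmetricmx_comb (R : realType) (m : nat) (s t : R) (A B : 'M[R]_m) :
  A \is symmetricmx -> B \is symmetricmx -> s *: A + t *: B \is symmetricmx.
Proof.
by move=> /symmetricmxP hA /symmetricmxP hB; apply/symmetricmxP;
  rewrite linearD !linearZ /= hA hB.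
Qed.

Lemma symmetricmx_congr (R : realType) (m k : nat) (A : 'M[R]_m)
    (C : 'M[R]_(m, k)) :
  A \is symmetricmx -> C^T *m A *m C \is symmetricmx.
Proof.
by move=> /symmetricmxP hA; apply/symmetricmxP;
  rewrite !trmx_mul trmxK hA mulmxA.
Qed.

Lemma symmetricmx_inv (R : realType) (m : nat) (A : 'M[R]_m) :
  A \is symmetricmx -> invmx A \is symmetricmx.
Proof.
by move=> /symmetricmxP hA; apply/symmetricmxP; rewrite trmx_inv hA.
Qed.

Lemma psdmx_comb (R : realType) (m : nat) (s t : R) (A B : 'M[R]_m) :
  0 <= s -> 0 <= t -> psdmx A -> psdmx B -> psdmx (s *: A + t *: B).
Proof.
move=> s0 t0 [sA hA] [sB hB]; split; first exact: symmetricmx_comb.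
by move=> x; rewrite quad_comb addr_ge0 ?mulr_ge0.
Qed.

Lemma psdmx_congr (R : realType) (m k : nat) (A : 'M[R]_m) (C : 'M[R]_(m, k)) :
  psdmx A -> psdmx (C^T *m A *m C).
Proof.
move=> [sA hA]; split; first exact: symmetricmx_congr.
by move=> x; rewrite quad_congr.
Qed.

Lemma pdmx_psdmx (R : realType) (m : nat) (A : 'M[R]_m) : pdmx A -> psdmx A.
Proof.
move=> [sA hA]; split=> // x.
have [-> | /hA/ltW //] := eqVneq x 0; by rewrite mulmx0 mxE.
Qed.

Lemma pdmx_unit (R : realType) (m : nat) (A : 'M[R]_m) :
  pdmx A -> A \in unitmx.
Proof.
move=> [_ hA]; rewrite unitmxE unitfE; apply/negP => /det0P[v v0 vA].
have vT0 : v^T != 0 by rewrite trmx_eq0.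
by have := hA _ vT0; rewrite trmxK vA mul0mx mxE ltxx.
Qed.

Lemma pdmx_inv (R : realType) (m : nat) (A : 'M[R]_m) :
  pdmx A -> pdmx (invmx A).
Proof.
move=> pA; have uA := pdmx_unit pA; have [sA hA] := pA.
split; first exact: symmetricmx_inv.
move=> x x0.
have /symmetricmxP sI := symmetricmx_inv sA.
(* The inverse of [A] is congruent to [A] through itself. *)
have -> : invmx A = (invmx A)^T *m A *m invmx A by rewrite sI mulVmx // mul1mx.
rewrite quad_congr; apply: hA; apply: contra x0 => /eqP e.
by rewrite -(mulKVmx uA x) e mulmx0.
Qed.

Lemma pdmx_above (R : realType) (m : nat) (A B : 'M[R]_m) :
  psdmx A -> loewner_lt A B -> pdmx B.
Proof.
move=> [sA hA] [sBA hBA].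
have -> : B = 1 *: A + 1 *: (B - A) by rewrite !scale1r addrC subrK.
split; first exact: symmetricmx_comb.
by move=> x x0; rewrite quad_comb !mul1r ltr_wpDl ?hBA // hA.
Qed.

(** * Inversion reverses the Loewner order *)

(** The difference of the inverses is a sum of two congruences,
    [M^-1 - N^-1 = (M^-1 - N^-1) M (M^-1 - N^-1) + N^-1 (N - M) N^-1],
    the first of a semidefinite matrix and the second of the assumed gap. *)
Lemma invmx_anti (R : realType) (m : nat) (M N : 'M[R]_m) :
  M \in unitmx -> N \in unitmx -> psdmx M -> N \is symmetricmx ->
  loewner_le M N -> loewner_le (invmx N) (invmx M).
Proof.
move=> uM uN pM sN pNM.
have /symmetricmxP sIM := symmetricmx_inv pM.1.
have /symmetricmxP sIN := symmetricmx_inv sN.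
set D := invmx M - invmx N.
have sD : D^T = D by rewrite /D linearB /= sIM sIN.
have e : D = 1 *: (D^T *m M *m D)
           + 1 *: ((invmx N)^T *m (N - M) *m invmx N).
  rewrite !scale1r sD sIN.
  have -> : D *m M = 1%:M - invmx N *m M by rewrite mulmxBl mulVmx.
  have -> : invmx N *m (N - M) = 1%:M - invmx N *m M by rewrite mulmxBr mulVmx.
  by rewrite -mulmxDr subrK mulmxBl mul1mx mulmxK.
rewrite /loewner_le -/D e.
by apply: psdmx_comb; rewrite ?ler01 //; apply: psdmx_congr.
Qed.

(** * Optimal weights *)

(** Moving a positive weight from [B] to the strictly smaller [A] strictly
    decreases the information, hence strictly increases the cost. *)
Lemma isotone_weight_eq0 (R : realType) (n : nat) (J : 'M[R]_n -> R)
    (A B : 'M[R]_n) (t : R) :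
  (0 < n)%N -> strictly_isotone J -> psdmx A -> loewner_lt A B ->
  0 <= t -> t <= 1 -> t *: A + (1 - t) *: B \in unitmx ->
  J (invmx (t *: A + (1 - t) *: B)) <= J (invmx B) -> t = 0.
Proof.
move=> n0 hJ pA AB t0 t1; set M := t *: A + _ => uM leJ.
have pB : pdmx B := pdmx_above pA AB.
have pM : psdmx M.
  by apply: psdmx_comb => //; [rewrite subr_ge0 | exact: pdmx_psdmx].
have gap : B - M = t *: (B - A).
  rewrite /M scalerBl scale1r scalerBr opprD opprB addrCA.
  by rewrite [B + _]addrC subrK addrC.
have leMB : loewner_le M B.
  rewrite /loewner_le gap -[_ *: _]addr0 -(scale0r B).
  by apply: psdmx_comb => //; exact: pdmx_psdmx.
have [_ ltJ] := hJ _ _ (symmetricmx_inv pB.1) (symmetricmx_inv pM.1)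
  (invmx_anti uM (pdmx_unit pB) pM pB.1 leMB).
apply/eqP; apply/negPn/negP => tn0.
suff neq : invmx B <> invmx M by have := ltJ neq; rewrite ltNge leJ.
move=> /(congr1 (@invmx R n)); rewrite !invmxK => BM.
have /eqP : t *: (B - A) = 0 by rewrite -gap BM subrr.
rewrite scaler_eq0 (negPf tn0) /= => /eqP BA0.
(* A positive dimension provides a nonzero vector, so the gap is not zero. *)
have x0 : const_mx 1 != 0 :> 'cV[R]_n.
  apply/eqP => /matrixP/(_ (Ordinal n0) 0); rewrite !mxE.
  by apply/eqP; rewrite oner_eq0.
by have := AB.2 _ x0; rewrite BA0 mulmx0 mul0mx mxE ltxx.
Qed.

Lemma psdmx_info1 (R : realType) (n p1 p2 : nat) (H1 : 'M[R]_(p1, n))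
    (d : DF R p1 p2) : psdmx (info1 H1 d).
Proof. by apply/psdmx_congr/pdmx_psdmx/pdmx_inv/Phat1_pd. Qed.

Lemma psdmx_info2 (R : realType) (n p1 p2 : nat) (H2 : 'M[R]_(p2, n))
    (d : DF R p1 p2) : psdmx (info2 H2 d).
Proof. by apply/psdmx_congr/pdmx_psdmx/pdmx_inv/Phat2_pd. Qed.

(** A nonzero vector cannot be annihilated by both [H1] and [H2], so at least
    one of the two nonnegative terms of the quadratic form is positive. *)
Lemma pdmx_fused (R : realType) (n p1 p2 : nat) (H1 : 'M[R]_(p1, n))
    (H2 : 'M[R]_(p2, n)) (Q1 : 'M[R]_p1) (Q2 : 'M[R]_p2) (s t : R) :
  \rank (col_mx H1 H2) = n -> pdmx Q1 -> pdmx Q2 -> 0 < s -> 0 < t ->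
  pdmx (s *: (H1^T *m Q1 *m H1) + t *: (H2^T *m Q2 *m H2)).
Proof.
move=> rkH pQ1 pQ2 s0 t0.
have [s1 h1] := pdmx_psdmx pQ1; have [s2 h2] := pdmx_psdmx pQ2.
split; first by apply: symmetricmx_comb; exact: symmetricmx_congr.
move=> x x0; rewrite quad_comb !quad_congr.
have [H1x | H1x] := eqVneq (H1 *m x) 0; last first.
  by apply: ltr_wpDr; [rewrite mulr_ge0 // ltW | rewrite mulr_gt0 // pQ1.2].
suff H2x : H2 *m x != 0.
  by apply: ltr_wpDl; [rewrite mulr_ge0 // ltW | rewrite mulr_gt0 // pQ2.2].
apply: contra x0 => /eqP H2x.
have full : row_free (col_mx H1 H2)^T by rewrite /row_free mxrank_tr rkH.
by rewrite -trmx_eq0 -(mulmx_free_eq0 _ full) -trmx_mul mul_col_mx H1x H2x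
  col_mx0 trmx0.
Qed.

(** The comparisons that competing weights provide are gathered here in a form
    that a function in [KH] and a solution of the CI problem both yield.  The
    two ordered cases are one, since exchanging the information matrices
    turns the weight [a] into [1 - a]. *)
Lemma KH_of_cost_bounds (R : realType) (n p1 p2 : nat)
    (H1 : 'M[R]_(p1, n)) (H2 : 'M[R]_(p2, n)) (J : 'M[R]_n -> R)
    (alpha : DF R p1 p2 -> {i01 R}) :
  (0 < n)%N -> strictly_isotone J ->
  (forall d, [/\ ci_info H1 H2 alpha d \in unitmx,
     loewner_lt (info1 H1 d) (info2 H2 d) ->
       J (invmx (ci_info H1 H2 alpha d)) <= J (invmx (info2 H2 d)) &
     loewner_lt (info2 H2 d) (info1 H1 d) ->
       J (invmx (ci_info H1 H2 alpha d)) <= J (invmx (info1 H1 d))]) ->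
  KH H1 H2 alpha.
Proof.
move=> n0 hJ H d; have [u le12 le21] := H d.
have a0 : 0 <= (alpha d)%:num by [].
have a1 : (alpha d)%:num <= 1 by [].
split=> // lt.
- exact: isotone_weight_eq0 n0 hJ (psdmx_info1 H1 d) lt a0 a1 u (le12 lt).
- have swap : ci_info H1 H2 alpha d = (1 - (alpha d)%:num) *: info2 H2 d
      + (1 - (1 - (alpha d)%:num)) *: info1 H1 d.
    by rewrite /ci_info subKr addrC.
  rewrite swap in u le21.
  have b0 : 0 <= 1 - (alpha d)%:num by rewrite subr_ge0.
  have b1 : 1 - (alpha d)%:num <= 1 by rewrite gerBl.
  have /eqP := isotone_weight_eq0 n0 hJ (psdmx_info2 H2 d) lt b0 b1 u (le21 lt).
  by rewrite subr_eq0 => /eqP ->.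
Qed.

Lemma Jbar_einvmx_le (R : realType) (n : nat) (J : 'M[R]_n -> R)
    (M : 'M[R]_n) (c : R) :
  (Jbar J (einvmx M) <= c%:E)%E -> M \in unitmx /\ J (invmx M) <= c.
Proof. by rewrite /einvmx; case: ifP => //= _; rewrite lee_fin. Qed.

Theorem theorem24 (R : realType) (n p1 p2 : nat)
    (n_gt0 : (0 < n)%N) (p1_gt0 : (0 < p1)%N) (p2_gt0 : (0 < p2)%N)
    (p1_le_n : (p1 <= n)%N) (p2_le_n : (p2 <= n)%N)
    (H1 : 'M[R]_(p1, n)) (H2 : 'M[R]_(p2, n))
    (hA1 : assumptionA1 H1 H2)
    (J : 'M[R]_n -> R) (hJ : strictly_isotone J) :
  (forall alpha' : DF R p1 p2 -> {i01 R},
     (exists alpha : DF R p1 p2 -> {i01 R},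
        KH H1 H2 alpha /\
        forall d : DF R p1 p2,
          (Jbar J (einvmx (ci_info H1 H2 alpha' d)) <=
           Jbar J (Some (Phat_alpha H1 H2 alpha d)))%E) ->
     KH H1 H2 alpha') /\
  (forall alphas : DF R p1 p2 -> {i01 R},
     CI_solution J H1 H2 alphas -> KH H1 H2 alphas).
Proof.
split.
  move=> alpha' [alpha [Kalpha le_alpha]].
  apply: (KH_of_cost_bounds n_gt0 hJ) => d.
  have [u leJ] := Jbar_einvmx_le (le_alpha d).
  have [K0 K1 _] := Kalpha d.
  split=> // lt; move: leJ; rewrite /Phat_alpha {2}/ci_info.
  - by rewrite K0 // scale0r add0r subr0 scale1r.
  - by rewrite K1 // subrr scale0r addr0 scale1r.
move=> alphas sol; apply: (KH_of_cost_bounds n_gt0 hJ) => d.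
have half_ge0 : 0 <= 2^-1 :> R by rewrite invr_ge0.
have half_lt1 : 2^-1 < 1 :> R by rewrite invf_lt1 // ltr1n.
have [_ _ rkH] := hA1.
pose half : DF R p1 p2 -> {i01 R} := fun=> Itv01 half_ge0 (ltW half_lt1).
have u_half : ci_info H1 H2 half d \in unitmx.
  apply/pdmx_unit/pdmx_fused => //; rewrite ?subr_gt0 ?invr_gt0 //.
  - exact/pdmx_inv/Phat1_pd.
  - exact/pdmx_inv/Phat2_pd.
have := sol d half; rewrite {2}/einvmx u_half => /Jbar_einvmx_le[u _].
split=> // lt.
- pose w : DF R p1 p2 -> {i01 R} := fun=> Itv01 (lexx 0) ler01.
  have := sol d w.
  have -> : ci_info H1 H2 w d = info2 H2 d.
    by rewrite /ci_info /= scale0r add0r subr0 scale1r.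
  rewrite {2}/einvmx (pdmx_unit (pdmx_above (psdmx_info1 H1 d) lt)).
  by case/Jbar_einvmx_le.
- pose w : DF R p1 p2 -> {i01 R} := fun=> Itv01 ler01 (lexx 1).
  have := sol d w.
  have -> : ci_info H1 H2 w d = info1 H1 d.
    by rewrite /ci_info /= subrr scale0r addr0 scale1r.
  rewrite {2}/einvmx (pdmx_unit (pdmx_above (psdmx_info2 H2 d) lt)).
  by case/Jbar_einvmx_le.
Qed.
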